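(* Let $T$ be a tree and $\mu:T\to\mathbb{R}$ any positive function. The differentiation operator $D$ is not an isometry on the weighted Banach space $L_\mu^\infty(T)$.
   Context: A tree $T$ is a locally finite, connected, simply-connected graph, identified with its set of vertices. A vertex is terminal if it has a unique neighbor; all trees are assumed to be without terminal vertices (hence infinite) and rooted at a vertex $o$. For $v\neq o$, $v^-$ denotes the unique neighbor of $v$ lying on the path from $o$ to $v$ (the parent of $v$). The derivative of $f:T\to\mathbb{C}$ is $f'(v)=f(v)-f(v^-)$ for $v\neq o$ and $f'(o)=0$; the differentiation operator is $Df=f'$. For a positive function (weight) $\mu:T\to\mathbb{R}$, the weighted Banach space $L_\mu^\infty(T)$ is the set of all $f:T\to\mathbb{C}$ with $\sup_{v\in T}\mu(v)|f(v)|<\infty$; it is a Banach space under $\|f\|_\mu=\sup_{v\in T}\mu(v)|f(v)|$. $D$ is an isometry on $L_\mu^\infty(T)$ if it maps $L_\mu^\infty(T)$ into itself and $\|Df\|_\mu=\|f\|_\mu$ for all $f\in L_\mu^\infty(T)$. *)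

(* Defs.v *)
From HB Require Import structures.
From mathcomp Require Import all_boot all_order all_algebra.
From mathcomp Require Import complex.
From mathcomp Require Import all_classical all_reals all_analysis.
Set Implicit Arguments.
Unset Strict Implicit.
Unset Printing Implicit Defensive.
Import Order.TTheory GRing.Theory Num.Theory.
Import numFieldNormedType.Exports.
Local Open Scope classical_set_scope.
Local Open Scope ring_scope.
Local Open Scope complex_scope.

Section Trees.
Variables (T : choiceType) (e : rel T).

Definition terminal (v : T) : Prop := exists! w, e v w.

(* [e] is the adjacency relation of a simple graph. [tree_acyclic] needs the
   bound 2 because in path.v an edge traversed back and forth is a ucycle of
   size 2. "Simply connected" is rendered as the absence of cycles. *)
Record is_tree : Prop := IsTree {
  tree_sym : symmetric e;
  tree_irr : irreflexive e;
  tree_locally_finite : forall v, finite_set [set w | e v w];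
  tree_connected : forall v w, exists2 p, path e v p & last v p = w;
  tree_acyclic : forall c, ucycle e c -> (size c <= 2)%N;
  tree_no_terminal : forall v, ~ terminal v }.

Definition is_path_from_to (v w : T) (p : seq T) : Prop :=
  [/\ path e v p, uniq (v :: p) & last v p = w].

Definition is_parent (o v w : T) : Prop :=
  e v w /\ exists2 p, is_path_from_to o v p & w \in o :: p.

(* For v != o in a tree this is the unique w with [is_parent o v w]; the
   default value o of [xget] is irrelevant, as the parent of o is never used. *)
Definition parent (o v : T) : T := xget o [set w | is_parent o v w].

End Trees.

Section Differentiation.
Variables (R : realType) (T : choiceType).

Definition derivative (e : rel T) (o : T) (f : T -> R[i]) : T -> R[i] :=
  fun v => if v == o then 0 else f v - f (parent e o v).

Definition wnorm (mu : T -> R) (f : T -> R[i]) : \bar R :=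
  ereal_sup [set (mu v * complex.Re `|f v|)%:E | v in [set: T]].

Definition Linfty (mu : T -> R) : set (T -> R[i]) :=
  [set f | (wnorm mu f < +oo)%E].

Definition isometry_on (mu : T -> R) (A : (T -> R[i]) -> (T -> R[i])) : Prop :=
  forall f, Linfty mu f -> Linfty mu (A f) /\ wnorm mu (A f) = wnorm mu f.

End Differentiation.

(* Main.v *)
Require Import Defs.
From mathcomp Require Import all_boot all_order all_algebra.
From mathcomp Require Import complex.
From mathcomp Require Import all_classical all_reals all_analysis.
Import Order.TTheory GRing.Theory Num.Theory.
Local Open Scope ring_scope.

(** Two test functions supported on the root [o] and one of its children refute
    the isometry property.

    The indicator [d] of [o] has norm [mu o], and its derivative has modulus 1
    at the children of [o] and vanishes elsewhere.  If [D] is an isometry, the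
    supremum of [mu] over the children of [o] is therefore [mu o]: every child
    [w] has [mu w <= mu o], and, as [mu o > 0], some child [w] has
    [mu w > mu o / 2] ([heavy_child]).

    Let [f] be 1 at [o], -1 at that [w], and 0 elsewhere.  Its norm is
    [mu o], but its derivative at [w] is -2, so the norm of the derivative
    is at least [2 * mu w > mu o]: a contradiction. *)

Section RootTestFunctions.
Set Implicit Arguments.
Unset Strict Implicit.
Variables (R : realType) (T : choiceType) (mu : T -> R).

Lemma wnorm_le (f : T -> R[i]) (M : R) :
  (forall v, mu v * complex.Re `|f v| <= M) -> (wnorm mu f <= M%:E)%E.
Proof.
by move=> fM; apply: ge_ereal_sup => _ [v _ <-]; rewrite lee_fin.
Qed.

Lemma wnorm_ge (f : T -> R[i]) v :
  ((mu v * complex.Re `|f v|)%:E <= wnorm mu f)%E.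
Proof. by apply: ereal_sup_ubound; exists v. Qed.

Lemma Linfty_bounded (f : T -> R[i]) (M : R) :
  (forall v, mu v * complex.Re `|f v| <= M) -> Linfty mu f.
Proof. by move=> /wnorm_le fM; apply: (le_lt_trans fM); rewrite ltry. Qed.

(** With [d] the indicator of [o], the equality of the norms of [D d] and [d]
    says that the weights of the children of [o] have supremum [mu o].  Since
    [mu o / 2 < mu o], some child exceeds [mu o / 2]. *)
Lemma heavy_child (e : rel T) (o : T) :
    (forall v, 0 < mu v) -> isometry_on mu (derivative e o) ->
  exists w, [/\ w != o, parent e o w = o, mu w <= mu o & mu o < mu w *+ 2].
Proof.
move=> mu_gt0 isoD.
pose d (v : T) : R[i] := if v == o then 1 else 0.
have d_le v : mu v * complex.Re `|d v| <= mu o.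
  rewrite /d; case: eqP => [->|_]; first by rewrite normr1 mulr1.
  by rewrite normr0 mulr0 ltW.
have [_ normDd] := isoD d (Linfty_bounded d_le).
have normd_ge := wnorm_ge d o.
rewrite {1}/d eqxx normr1 mulr1 -normDd in normd_ge.
have Dd_child v : v != o -> parent e o v = o -> `|derivative e o d v| = 1.
  move=> vo pv; rewrite /derivative (negPf vo) pv /d eqxx (negPf vo).
  by rewrite sub0r normrN1.
have Dd_other v : ~ (v != o /\ parent e o v = o) -> derivative e o d v = 0.
  rewrite /derivative /d; case: (eqVneq v o) => // vo nchild.
  by case: eqP => [pv|_]; [case: nchild | rewrite subr0].
have [[w [wo pw w_heavy]]|no_heavy] := pselect (exists w,
    [/\ w != o, parent e o w = o & mu o < mu w *+ 2]).
  exists w; split=> //.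
  have := wnorm_le d_le; rewrite -normDd => /(le_trans (wnorm_ge _ w)).
  by rewrite Dd_child // mulr1 lee_fin.
(* Without a heavy child, the derivative of [d] has norm at most [mu o / 2]. *)
suff /wnorm_le/(le_trans normd_ge) :
    forall v, mu v * complex.Re `|derivative e o d v| <= mu o / 2.
  by rewrite lee_fin leNgt ltr_pdivrMr // mulr_natr mulr2n ltrDl mu_gt0.
move=> v; have [[vo pv]|/Dd_other ->] := pselect (v != o /\ parent e o v = o).
  rewrite Dd_child // mulr1 ler_pdivlMr // mulr_natr leNgt.
  by apply/negP => v_heavy; apply: no_heavy; exists v.
by rewrite normr0 mulr0 divr_ge0 // ltW.
Qed.

End RootTestFunctions.

Theorem corollary4p5 (R : realType) (T : choiceType) (e : rel T) (o : T)
    (hT : is_tree e) (mu : T -> R) (hmu : forall v : T, 0 < mu v) :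
  ~ isometry_on mu (@derivative R T e o).
Proof.
move=> isoD; have [w [wo pw w_le w_heavy]] := heavy_child hmu isoD.
pose f (v : T) : R[i] := if v == o then 1 else if v == w then -1 else 0.
have f_le v : mu v * complex.Re `|f v| <= mu o.
  rewrite /f; case: eqP => [->|_]; first by rewrite normr1 mulr1.
  case: eqP => [->|_]; first by rewrite normrN1 mulr1.
  by rewrite normr0 mulr0 ltW.
have [_ normDf] := isoD f (Linfty_bounded f_le).
have := wnorm_le f_le; rewrite -normDf => /(le_trans (wnorm_ge mu _ w)).
have -> : derivative e o f w = - (2%:R).
  by rewrite /derivative (negPf wo) pw /f !eqxx (negPf wo) -opprD.
rewrite normrN normr_nat raddfMn /= lee_fin mulr_natr.
by rewrite leNgt w_heavy.
Qed.
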